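(* For every document, the semantic functions $\mathrm{supers}$, $\mathrm{overrides}$, $\mathrm{bases}$, $\mathrm{resolve}$, $\mathrm{this}$ are well-defined: the immediate consequence operator $T_P$ has a unique least fixed point $\mathrm{lfp}(T_P)$, and the denotational semantics of the five functions is (the corresponding components of) $\mathrm{lfp}(T_P)$.
   Context: **Documents.** A node is a scalar (a tag and a string), a sequence (a tag and a finite list of nodes) or a mapping (a tag and a finite list of pairs of nodes). The relevant tags are !!seq, !!map, !!str, !!null. A program (document, AST) is a node $\mathrm{doc}$. Labels are strings; a path is a finite sequence of labels; $()$ is the root path; $p\triangleright\ell$ appends a label; $p\frown w$ concatenates a label sequence; for $p\ne()$, $\mathrm{init}(p)$ drops the last label and $\mathrm{last}(p)$ is the last label (both undefined at $()$). Set comprehensions silently omit terms in which a partial function is undefined, and are empty if their source is undefined. **Syntactic helpers.** $\mathrm{items}(\mathit{node})$ is the list of children if $\mathit{node}$ is a !!seq sequence (undefined otherwise). $\mathrm{kv}(\mathit{node})=(\ell,m)$ if $\mathit{node}$ is a !!map mapping with exactly one pair, whose key is a !!str scalar with content $\ell$ and whose value is $m$ (undefined otherwise). $\mathrm{at}(())=\mathrm{doc}$; $\mathrm{at}(p\triangleright\ell)$ is the unique $m$ with $(\ell,m)=\mathrm{kv}(\mathit{node})$ for some $\mathit{node}\in\mathrm{items}(\mathrm{at}(p))$. $\mathrm{has}(p,\ell)$ holds iff some $\mathit{node}\in\mathrm{items}(\mathrm{at}(p))$ has $\mathrm{kv}(\mathit{node})=(\ell,\_)$. $\mathrm{lexical}(p,\ell)=0$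 if $\mathrm{has}(p,\ell)$, else $1+\mathrm{lexical}(\mathrm{init}(p),\ell)$. $\mathrm{qualified}(p,\ell)=0$ if $\mathrm{last}(p)=\ell$, else $1+\mathrm{qualified}(\mathrm{init}(p),\ell)$. For a list of scalars $r=(s_1,\dots,s_k)$: if $s_2$ is !!null, $\mathrm{indexed}(p,r)=(\mathrm{qualified}(\mathrm{init}(p),s_1),(s_3,\dots,s_k))$; otherwise $\mathrm{indexed}(p,r)=(\mathrm{lexical}(\mathrm{init}(p),s_1),(s_1,\dots,s_k))$ (scalars read as labels, requiring !!str). $\mathrm{dom}(\mathrm{inherits})=\{p: p=()\text{ or }\mathrm{has}(\mathrm{init}(p),\mathrm{last}(p))\}$, and for $p$ in it $\mathrm{inherits}(p)=\{\mathrm{indexed}(p,\mathrm{items}(r)) : r\in\mathrm{items}(\mathrm{at}(p))\}\subseteq\mathbb N\times\mathrm{Label}^*$. **Equations.** The five functions are specified by the mutually recursive equations: - $\mathrm{supers}(())=\{((),())\}$; $\mathrm{supers}(p\triangleright\ell)=\{(\mathrm{init}(b),o): b\in\mathrm{bases}^*(p\triangleright\ell),\ o\in\mathrm{overrides}(b)\}$, with $\mathrm{bases}^*$ the reflexive-transitive closure; - $\mathrm{overrides}(())=\{()\}$; $\mathrm{overrides}(p\triangleright\ell)=\{o : (\_,b)\in\mathrm{supers}(p),\ b\triangleright\ell\in\mathrm{dom}(\mathrm{inherits}),\ o\in\{p\triangleright\ell,\,b\triangleright\ell\}\}$; - $\mathrm{bases}(())=\varnothing$; $\mathrm{bases}(p\triangleright\ell)=\{t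 : o\in\mathrm{overrides}(p\triangleright\ell),\ (n,w)\in\mathrm{inherits}(o),\ t\in\mathrm{resolve}(p,o,n,w)\}$; - $\mathrm{resolve}(s,d,n,w)=\{c\frown w : c\in\mathrm{this}(\{s\},\mathrm{init}(d),n)\}$; - $\mathrm{this}(S,d,0)=S$; for $n>0$, $\mathrm{this}(S,d,n)=\mathrm{this}(\{t: c\in S,\ (t,d)\in\mathrm{supers}(c)\},\mathrm{init}(d),n-1)$. **Operator $T_P$.** Let $\mathcal Q$ be the set of all queries $\mathrm{supers}(p),\mathrm{overrides}(p),\mathrm{bases}(p),\mathrm{resolve}(s,d,n,w),\mathrm{this}(S,d,n)$. For $q\in\mathcal Q$ let $\mathcal V_q$ be the set of pairs of paths if $q$ is a $\mathrm{supers}$ query, and the set of paths otherwise. A query--answer map is an element $M$ of $\prod_{q\in\mathcal Q}\mathcal P(\mathcal V_q)$, ordered by pointwise inclusion. $T_P(M)(q)$ is the set of values produced by the right-hand side of the equation for $q$, with every sub-query $q'$ read as $M(q')$; $\mathrm{bases}^*$ is the reflexive-transitive closure of the relation assembled from the values $M(\mathrm{bases}(\cdot))$; and the $\mathrm{this}$ equation is unfolded per singleton frontier: for non-singleton $S$, $T_P(M)(\mathrm{this}(S,d,n))=\bigcup_{s\in S}M(\mathrm{this}(\{s\},d,n))$; $T_P(M)(\mathrm{this}(\{s\},d,0))=\{s\}$; for $n>0$, $T_P(M)(\mathrm{this}(\{s\},d,n))=\bigcup_{(t,d)\in M(\mathrm{supers}(s))}M(\mathrm{this}(\{t\},\mathrm{init}(d),n-1))$.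 *)

(* Defs.v *)
From Stdlib Require Import String Relations.
From mathcomp Require Import all_boot.
From mathcomp Require Import boolp classical_sets.

Set Implicit Arguments.
Unset Strict Implicit.
Unset Printing Implicit Defensive.

Local Open Scope classical_set_scope.

(* Partial functions are rendered either with [option] or, for the recursive
   ones, as their graph.  A set comprehension containing an undefined term
   simply has no element for that term. *)

Inductive tag : Type :=
| TSeq                          (* !!seq *)
| TMap                          (* !!map *)
| TStr                          (* !!str *)
| TNull                         (* !!null *)
| TOther of string.

Inductive node : Type :=
| Scalar of tag & string
| Sequence of tag & seq node
| Mapping of tag & seq (node * node).

Definition label : Type := string.

(* The root path is [::]; p extended by the label l is [rcons p l]. *)
Definition path : Type := seq label.

(* unsnoc (rcons p l) = Some (p, l) *)
Definition unsnoc (p : path) : option (path * label) :=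
  if p is l :: w then Some (belast l w, last l w) else None.

Definition init (p : path) : option path := omap fst (unsnoc p).

Definition items (nd : node) : option (seq node) :=
  if nd is Sequence TSeq nds then Some nds else None.

Definition kv (nd : node) : option (label * node) :=
  if nd is Mapping TMap [:: (Scalar TStr l, m)] then Some (l, m) else None.

(* [child nd] is a member of items([nd]); false when the latter is undefined. *)
Definition is_item (nd child : node) : Prop :=
  exists2 nds, items nd = Some nds & List.In child nds.

Definition entry (nd : node) (l : label) (m : node) : Prop :=
  exists2 child, is_item nd child & kv child = Some (l, m).

(* node_at doc p m : at(p) is defined and equal to m.  Two entries with the
   same label and distinct values make at undefined. *)
Inductive node_at (doc : node) : path -> node -> Prop :=
| node_at_root : node_at doc [::] doc
| node_at_rcons p l nd m :
    node_at doc p nd -> unique (entry nd l) m -> node_at doc (rcons p l) m.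

Definition has_label (doc : node) (p : path) (l : label) : Prop :=
  exists2 nd, node_at doc p nd & exists m, entry nd l m.

Inductive lexical (doc : node) : path -> label -> nat -> Prop :=
| lexical_here p l : has_label doc p l -> lexical doc p l 0
| lexical_up p k l n :
    ~ has_label doc (rcons p k) l ->
    lexical doc p l n -> lexical doc (rcons p k) l n.+1.

Inductive qualified : path -> label -> nat -> Prop :=
| qualified_here p l : qualified (rcons p l) l 0
| qualified_up p k l n :
    k <> l -> qualified p l n -> qualified (rcons p k) l n.+1.

(* Every scalar read as a label must be tagged !!str; in particular the second
   scalar, when present, is !!null in the first case and !!str in the second. *)
Inductive indexed (doc : node) (p : path) : seq node -> nat * seq label -> Prop :=
| indexed_qualified q l c w n :
    init p = Some q -> qualified q l n ->
    indexed doc p (Scalar TStr l :: Scalar TNull c :: map (Scalar TStr) w) (n, w)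
| indexed_lexical q l w n :
    init p = Some q -> lexical doc q l n ->
    indexed doc p (map (Scalar TStr) (l :: w)) (n, l :: w).

Definition dom_inherits (doc : node) : set path :=
  [set p | p = [::] \/
    exists q l, unsnoc p = Some (q, l) /\ has_label doc q l].

Definition inherits (doc : node) (p : path) : set (nat * seq label) :=
  [set x | dom_inherits doc p /\
    exists nd r ss, [/\ node_at doc p nd, is_item nd r, items r = Some ss &
                        indexed doc p ss x]].

Record semantics : Type := Semantics {
  supers : path -> set (path * path);
  overrides : path -> set path;
  bases : path -> set path;
  resolve : path -> path -> nat -> seq label -> set path;
  this : set path -> path -> nat -> set path
}.

Definition bases_star (F : semantics) : path -> path -> Prop :=
  clos_refl_trans path (fun p t => bases F p t).

(* Right-hand sides of the equations, with sub-queries answered by [F]. *)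

Definition supers_rhs (F : semantics) (p : path) : set (path * path) :=
  if p is [::] then [set ([::], [::])] else
  [set x | exists b, [/\ bases_star F p b, init b = Some x.1 &
                         overrides F b x.2]].

Definition overrides_rhs (doc : node) (F : semantics) (q : path) : set path :=
  if unsnoc q is Some (p, l) then
    [set o | exists a b, [/\ supers F p (a, b), dom_inherits doc (rcons b l) &
                             o = rcons p l \/ o = rcons b l]]
  else [set [::]].

Definition bases_rhs (doc : node) (F : semantics) (q : path) : set path :=
  if unsnoc q is Some (p, l) then
    [set t | exists o n w, [/\ overrides F (rcons p l) o, inherits doc o (n, w) &
                               resolve F p o n w t]]
  else set0.

Definition resolve_rhs (F : semantics) (s d : path) (n : nat) (w : seq label)
    : set path :=
  if init d is Some e then [set c ++ w | c in this F [set s] e n] else set0.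

(* this(S, (), n) with n > 0 is undefined (init(()) is), hence contributes
   nothing to the comprehensions ranging over it: it is read as empty. *)
Definition this_rhs (F : semantics) (S : set path) (d : path) (n : nat)
    : set path :=
  if n is m.+1 then
    if init d is Some e then
      this F [set t | exists2 c, S c & supers F c (t, d)] e m
    else set0
  else S.

Definition equations (doc : node) (F : semantics) : Prop :=
  [/\ forall p, supers F p = supers_rhs F p,
      forall p, overrides F p = overrides_rhs doc F p,
      forall p, bases F p = bases_rhs doc F p,
      forall s d n w, resolve F s d n w = resolve_rhs F s d n w &
      forall S d n, this F S d n = this_rhs F S d n].

Definition semantics_le (F G : semantics) : Prop :=
  [/\ forall p, supers F p `<=` supers G p,
      forall p, overrides F p `<=` overrides G p,
      forall p, bases F p `<=` bases G p,
      forall s d n w, resolve F s d n w `<=` resolve G s d n w &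
      forall S d n, this F S d n `<=` this G S d n].

(* The meaning of the mutually recursive specification: its least solution. *)
Definition denotational_semantics (doc : node) (F : semantics) : Prop :=
  equations doc F /\ forall G, equations doc G -> semantics_le F G.

Inductive query : Type :=
| QSupers of path
| QOverrides of path
| QBases of path
| QResolve of path & path & nat & seq label
| QThis of set path & path & nat.

Definition value (q : query) : Type :=
  if q is QSupers _ then (path * path)%type else path.

Definition answer_map : Type := forall q : query, set (value q).

Definition answer_le (M N : answer_map) : Prop := forall q, M q `<=` N q.

Definition components (M : answer_map) : semantics := {|
  supers := fun p => M (QSupers p);
  overrides := fun p => M (QOverrides p);
  bases := fun p => M (QBases p);
  resolve := fun s d n w => M (QResolve s d n w);
  this := fun S d n => M (QThis S d n)
|}.

Definition T_this_singleton (M : answer_map) (s d : path) (n : nat) : set path :=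
  if n is m.+1 then
    if init d is Some e then
      [set v | exists2 t, M (QSupers s) (t, d) & M (QThis [set t] e m) v]
    else set0
  else [set s].

Definition T_this (M : answer_map) (S : set path) (d : path) (n : nat)
    : set path :=
  [set v | (exists s, S = [set s] /\ T_this_singleton M s d n v) \/
           (~ (exists s, S = [set s]) /\
            exists2 s, S s & M (QThis [set s] d n) v)].

(* The immediate consequence operator T_P of the program [doc]. *)
Definition T (doc : node) (M : answer_map) : answer_map := fun q =>
  match q return set (value q) with
  | QSupers p => supers_rhs (components M) p
  | QOverrides p => overrides_rhs doc (components M) p
  | QBases p => bases_rhs doc (components M) p
  | QResolve s d n w => resolve_rhs (components M) s d n w
  | QThis A d n => T_this M A d n
  end.
Arguments T : clear implicits.

Definition least_fixpoint (f : answer_map -> answer_map) (M : answer_map) : Prop :=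
  f M = M /\ forall N, f N = N -> answer_le M N.

(* Main.v *)
Require Import Defs.
From Stdlib Require Import Relations.
From mathcomp Require Import all_boot.
From mathcomp Require Import boolp classical_sets.

(** [T doc] is monotone, so by Knaster and Tarski the intersection of its
    pre-fixed points is its least fixed point.  The equations and [T doc] only
    differ in the frontier argument of [this]: the operator unfolds singletons
    and takes unions, the equation carries the whole frontier along.  In a
    solution of either system [this] is additive in the frontier, so the fixed
    points of [T doc] are exactly the solutions of the equations, and the least
    ones correspond. *)

Set Implicit Arguments.
Unset Strict Implicit.
Unset Printing Implicit Defensive.

Local Open Scope classical_set_scope.

Lemma answer_map_eqP (M N : answer_map) : (forall q, M q = N q) -> M = N.
Proof. exact: functional_extensionality_dep. Qed.

Lemma answer_le_anti (M N : answer_map) :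
  answer_le M N -> answer_le N M -> M = N.
Proof. by move=> MN NM; apply: answer_map_eqP => q; apply/seteqP. Qed.

Definition monotone (f : answer_map -> answer_map) : Prop :=
  forall M N, answer_le M N -> answer_le (f M) (f N).

Definition lfp (f : answer_map -> answer_map) : answer_map :=
  fun q => [set v | forall M, answer_le (f M) M -> M q v].

Lemma lfp_least f : monotone f -> least_fixpoint f (lfp f).
Proof.
move=> f_mono.
have lfp_le M : answer_le (f M) M -> answer_le (lfp f) M by move=> fM q v; apply.
have lfp_pre : answer_le (f (lfp f)) (lfp f).
  by move=> q v fv M fM; apply: (fM); apply: f_mono fv; apply: lfp_le.
split; last by move=> N fN; apply: lfp_le; rewrite fN => q v.
(* By monotonicity [f (lfp f)] is itself a pre-fixed point, hence lies above [lfp f]. *)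
by apply: answer_le_anti => //; apply: lfp_le; apply: f_mono.
Qed.

Lemma least_fixpoint_unique f M N :
  least_fixpoint f M -> least_fixpoint f N -> M = N.
Proof.
by move=> [fM leM] [fN leN]; apply: answer_le_anti; [apply: leM|apply: leN].
Qed.

(** Inverse to [components]: it lets a minimality claim over all [semantics] be tested on answer
    maps. *)
Definition answers (F : semantics) : answer_map := fun q =>
  match q return set (value q) with
  | QSupers p => supers F p
  | QOverrides p => overrides F p
  | QBases p => bases F p
  | QResolve s d n w => resolve F s d n w
  | QThis A d n => this F A d n
  end.

Lemma answersK F : components (answers F) = F.
Proof. by case: F. Qed.

Lemma semantics_le_components M N :
  semantics_le (components M) (components N) <-> answer_le M N.
Proof.
split=> [[les leo leb ler let_] [p|p|p|s d n w|S d n]|leMN].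
- exact: les.
- exact: leo.
- exact: leb.
- exact: ler.
- exact: let_.
split=> [p|p|p|s d n w|S d n].
- exact: (leMN (QSupers p)).
- exact: (leMN (QOverrides p)).
- exact: (leMN (QBases p)).
- exact: (leMN (QResolve s d n w)).
- exact: (leMN (QThis S d n)).
Qed.

Lemma bases_star_mono F G :
  semantics_le F G -> forall p t, bases_star F p t -> bases_star G p t.
Proof.
move=> [_ _ leb _ _] p t; elim=> [x y|x|x y z _ xy _ yz].
- by move=> /leb; apply: rt_step.
- exact: rt_refl.
- exact: rt_trans xy yz.
Qed.

Lemma T_this_singleton_mono M N s d n :
  answer_le M N -> T_this_singleton M s d n `<=` T_this_singleton N s d n.
Proof.
move=> leMN; case: n => [//|m] v /=; case: (init d) => [e|//].
by case=> t /leMN sup /leMN tv; exists t.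
Qed.

(** Sub-query answers occur only positively on the right-hand sides, and the case split in [T_this]
    tests the frontier alone, so both maps take the same branch. *)
Lemma T_mono doc : monotone (T doc).
Proof.
move=> M N leMN; have leF := leMN; move/semantics_le_components in leF.
have [les leo leb ler let_] := leF.
case=> [[|l p]|p|p|s d n w|A d n] v //=.
- move=> [b [star ib ov]]; exists b; split=> //.
    exact: bases_star_mono leF _ _ star.
  exact: leo ov.
- rewrite /overrides_rhs; case: (unsnoc p) => [[q l]|//] [a [b [sup dom vE]]].
  by exists a, b; split=> //; apply: les sup.
- rewrite /bases_rhs; case: (unsnoc p) => [[q l]|//] [o [n [w [ov inh res]]]].
  by exists o, n, w; split=> //; [apply: leo ov|apply: ler res].
- rewrite /resolve_rhs; case: (init d) => [e|//] [c /let_ cM <-].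
  by exists c.
- case=> [[s [AE sv]]|[nA [s As sv]]]; [left|right].
    by exists s; split=> //; apply: T_this_singleton_mono sv.
  by split=> //; exists s => //; apply: leMN sv.
Qed.

Definition this_additive (F : semantics) : Prop :=
  forall S d n, this F S d n = \bigcup_(s in S) this F [set s] d n.

(** The next frontier is a union of contributions of the single members of [S]. Assuming additivity
    only below [n] makes this usable as an induction step. *)
Lemma this_rhs_additive F S d n :
  (forall m, m < n -> forall A e,
     this F A e m = \bigcup_(s in A) this F [set s] e m) ->
  this_rhs F S d n = \bigcup_(s in S) this_rhs F [set s] d n.
Proof.
case: n => [_|m addF] /=; first by rewrite bigcup_imset1 image_id.
case: (init d) => [e|]; last by rewrite bigcup0.
apply/seteqP; split=> v.
  rewrite addF // => -[t [c Sc ct] tv]; exists c => //.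
  by rewrite addF //; exists t => //; exists c.
case=> c Sc; rewrite addF // => -[t [_ -> ct] tv].
by rewrite addF //; exists t => //; exists c.
Qed.

(** The operator queries each successor [t] separately, the equation queries the set of all of them
    at once; additivity identifies the two. *)
Lemma T_this_singletonE M s d n : this_additive (components M) ->
  T_this_singleton M s d n = this_rhs (components M) [set s] d n.
Proof.
move=> addM; case: n => [//|m] /=; case: (init d) => [e|//].
rewrite [RHS](addM _ e m); apply/seteqP; split=> v [t].
  by move=> st tv; exists t => //; exists s.
by move=> [_ -> st] tv; exists t.
Qed.

Lemma T_this_set1 M s d n : T_this M [set s] d n = T_this_singleton M s d n.
Proof.
apply/seteqP; split=> v; last by left; exists s.
case=> [[t [st]]|[[]]]; last by exists s.
(* [s = t] is by conversion membership of [s] in [[set t]], which equals [[set s]]. *)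
by have -> : s = t by rewrite -[s = t]/([set t] s) -st.
Qed.

Lemma T_this_frontier M S d n : ~ (exists s, S = [set s]) ->
  T_this M S d n = \bigcup_(s in S) M (QThis [set s] d n).
Proof.
move=> nS; apply/seteqP; split=> v; last by right.
by case=> [[s [SE _]]|[]//]; case: nS; exists s.
Qed.

Lemma fixpoint_this_additive doc M :
  T doc M = M -> this_additive (components M).
Proof.
move=> fixM S d n; have [[s ->]|nS] := pselect (exists s, S = [set s]).
  by rewrite bigcup_set1.
have -> : this (components M) S d n = T doc M (QThis S d n) by rewrite fixM.
exact: T_this_frontier.
Qed.

(** Strong induction on the depth [n], since each unfolding lowers it while changing both frontier
    and path. *)
Lemma equations_this_additive doc F : equations doc F -> this_additive F.
Proof.
move=> [_ _ _ _ eqF] S d n; elim/ltn_ind: n S d => n IH S d.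
by rewrite eqF this_rhs_additive //; apply: eq_bigcupr => s _; rewrite eqF.
Qed.

Lemma fixpoint_equationsP doc M :
  T doc M = M <-> equations doc (components M).
Proof.
split=> [fixM|eqM].
  have fixE q : M q = T doc M q by rewrite fixM.
  have addM := fixpoint_this_additive fixM.
  split=> [p|p|p|s d n w|S d n].
  - exact: (fixE (QSupers p)).
  - exact: (fixE (QOverrides p)).
  - exact: (fixE (QBases p)).
  - exact: (fixE (QResolve s d n w)).
  (* Both sides are additive in the frontier, so singletons suffice. *)
  rewrite [LHS]addM this_rhs_additive //; apply: eq_bigcupr => s _.
  rewrite -T_this_singletonE // -T_this_set1.
  exact: (fixE (QThis [set s] d n)).
have addM := equations_this_additive eqM; case: eqM => eqs eqo eqb eqr eqt.
apply: answer_map_eqP => -[p|p|p|s d n w|S d n] /=.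
- by rewrite -eqs.
- by rewrite -eqo.
- by rewrite -eqb.
- by rewrite -eqr.
have [[s ->]|nS] := pselect (exists s, S = [set s]).
  by rewrite T_this_set1 T_this_singletonE //; symmetry; apply: eqt.
by rewrite T_this_frontier //; symmetry; apply: addM.
Qed.

Lemma denotational_least_fixpointP doc M :
  denotational_semantics doc (components M) <-> least_fixpoint (T doc) M.
Proof.
split=> -[/fixpoint_equationsP fixM leM]; split=> // N.
  by move/fixpoint_equationsP/leM/semantics_le_components.
rewrite -(answersK N) => /fixpoint_equationsP/leM.
by move/semantics_le_components.
Qed.

Theorem theoremA5 (doc : node) :
  (exists! M : answer_map, least_fixpoint (T doc) M) /\
  (forall M : answer_map, least_fixpoint (T doc) M ->
     forall F : semantics, denotational_semantics doc F <-> F = components M).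
Proof.
split.
  exists (lfp (T doc)); split; first exact: lfp_least (T_mono (doc := doc)).
  by move=> N; apply: least_fixpoint_unique; apply: lfp_least; apply: T_mono.
move=> M lfpM F; split=> [|->]; last exact/denotational_least_fixpointP.
(* [answers F] is then a least fixed point, hence equal to [M]. *)
rewrite -{1}(answersK F) => /denotational_least_fixpointP lfpF.
by rewrite -(answersK F) (least_fixpoint_unique lfpF lfpM).
Qed.
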